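(* Let $\Bbbk$ be an algebraically closed field of characteristic $0$, and suppose that $A^G$ is a quantum Kleinian singularity over $\Bbbk$. Then there is a ring isomorphism $$\operatorname{End}_{A^G}(A) \cong A \,\#\, G,$$ where $A$ is viewed as a right $A^G$-module.
   Context: For $q\in\Bbbk^\times$ the quantum plane is $\Bbbk_q[u,v] = \Bbbk\langle u,v\rangle/\langle vu - quv\rangle$, and the Jordan plane is $\Bbbk_J[u,v] = \Bbbk\langle u,v\rangle/\langle vu-uv-u^2\rangle$. ''$A^G$ is a quantum Kleinian singularity'' means that $(A,G)$ is one of the following pairs (where $n$ is a positive integer), with $G$ acting by $\Bbbk$-algebra automorphisms, and $A^G$ is its ring of invariants: (i) $A = \Bbbk_q[u,v]$ with $q\in\Bbbk^\times$, and $G = C_{n+1}=\langle g\rangle$ cyclic of order $n+1$, acting by $g\cdot u = \omega u$, $g\cdot v = \omega^{-1}v$, with $\omega$ a primitive $(n+1)$th root of unity; (ii) $A = \Bbbk_{-1}[u,v]$ and $G = S_2 = \langle h \mid h^2\rangle$, acting by $h\cdot u = v$, $h\cdot v = u$; (iii) $A = \Bbbk_{-1}[u,v]$ and $G = D_n = \langle g,h \mid g^n,h^2,(hg)^2\rangle$ dihedral of order $2n$, acting by $g\cdot u = \omega u$, $g\cdot v=\omega^{-1}v$, $h\cdot u = v$, $h\cdot v=u$, with $\omega$ a primitive $n$th root of unity; (iv) $A = \Bbbk_J[u,v]$ and $G = C_2 = \langle g\rangle$, acting by $g\cdot u=-u$, $g\cdot v = -v$. The skew group ring $A \,\#\, G$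 is the free left $A$-module with basis $G$ and multiplication $(ax)(by) = a\,(x\cdot b)\, xy$ for $a,b\in A$, $x,y\in G$. *)

(* Defs.v *)
From HB Require Import structures.
From mathcomp Require Import all_boot all_order all_fingroup all_algebra.
From mathcomp Require Import generic_quotient ring_quotient boolp.
From mathcomp Require Import finmap monalg.

Set Implicit Arguments.
Unset Strict Implicit.
Unset Printing Implicit Defensive.

Import GRing.Theory.

Local Open Scope ring_scope.
Local Open Scope quotient_scope.

Lemma malg_scalerAr (K : monomType) (R : comNzRingType) (c : R)
    (x y : {malg R[K]}) : c *: (x * y) = x * (c *: y).
Proof.
apply/malgP=> m; rewrite mcoeffZ (mcoeffMl x y).
rewrite (mcoeffMlw m (fsubset_refl (msupp x)) (msuppZ_le c y)).
rewrite mulr_sumr; apply: eq_bigr => i _.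
rewrite mulr_sumr; apply: eq_bigr => j _.
by rewrite mcoeffZ mulrCA mulrnAr.
Qed.

(* [k<u,v>] is the monoid algebra of the free monoid on two letters.  The
   alias carries the [algType] instance, which [malg] declares only for
   commutative monoids. *)
Definition free_alg (k : fieldType) : Type := {malg k[{fmonom 'I_2}]}.

Section FreeAlgebra.
Context (k : fieldType).

HB.instance Definition _ := GRing.Lalgebra.on (free_alg k).

Lemma free_alg_scalerAr (c : k) (x y : free_alg k) :
  c *: (x * y) = x * (c *: y).
Proof. exact: (malg_scalerAr c x y). Qed.

HB.instance Definition _ :=
  GRing.Lalgebra_isAlgebra.Build k (free_alg k) free_alg_scalerAr.

Definition free_u : free_alg k := << fmu (ord0 : 'I_2) >>.
Definition free_v : free_alg k := << fmu (ord_max : 'I_2) >>.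

Definition free_const (x : free_alg k) : k :=
  mcoeff (mone : {fmonom 'I_2}) x.

HB.instance Definition _ := GRing.RMorphism.copy free_const
  (mcoeff (mone : {fmonom 'I_2}) : {malg k[{fmonom 'I_2}]} -> k).
HB.instance Definition _ :=
  GRing.isScalable.Build k (free_alg k) k *%R free_const
    (fun c x => mcoeffZ c x _).

Lemma free_const_u : free_const free_u = 0.
Proof. by rewrite /free_const mcoeffU1 fmP fmU fm1. Qed.

Lemma free_const_v : free_const free_v = 0.
Proof. by rewrite /free_const mcoeffU1 fmP fmU fm1. Qed.

End FreeAlgebra.

Section IdealGen.
Context (k : fieldType) (F : algType k) (rel : F).

(* the two-sided ideal generated by [rel] *)
Definition ideal_gen : pred F := fun x =>
  `[< exists s : seq (F * F),
        x = \sum_(p <- s) p.1 * rel * p.2 >].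

Lemma ideal_genP (x : F) :
  reflect (exists s : seq (F * F),
             x = \sum_(p <- s) p.1 * rel * p.2)
          (x \in ideal_gen).
Proof. exact: asboolP. Qed.

Lemma ideal_gen_zmod_closed : zmod_closed ideal_gen.
Proof.
split=> [|x y /ideal_genP[s ->] /ideal_genP[t ->]].
  by apply/ideal_genP; exists [::]; rewrite big_nil.
apply/ideal_genP; exists (s ++ [seq (- p.1, p.2) | p <- t]).
rewrite big_cat big_map /= -sumrN; congr (_ + _).
by apply: eq_bigr => p _; rewrite !mulNr.
Qed.

HB.instance Definition _ :=
  GRing.isZmodClosed.Build F ideal_gen ideal_gen_zmod_closed.

Lemma ideal_genMl (a x : F) : x \in ideal_gen -> a * x \in ideal_gen.
Proof.
move=> /ideal_genP[s ->]; apply/ideal_genP.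
exists [seq (a * p.1, p.2) | p <- s]; rewrite big_map mulr_sumr /=.
by apply: eq_bigr => p _; rewrite !mulrA.
Qed.

Lemma ideal_genMr (x a : F) : x \in ideal_gen -> x * a \in ideal_gen.
Proof.
move=> /ideal_genP[s ->]; apply/ideal_genP.
exists [seq (p.1, p.2 * a) | p <- s]; rewrite big_map mulr_suml /=.
by apply: eq_bigr => p _; rewrite !mulrA.
Qed.

Lemma ideal_gen_const (eps : {rmorphism F -> k}) :
  eps rel = 0 -> 1 \notin ideal_gen.
Proof.
move=> eps0; apply/negP => /ideal_genP[s] /(congr1 eps).
rewrite rmorph1 rmorph_sum big1 => [/eqP|p _]; first by rewrite oner_eq0.
by rewrite !rmorphM /= eps0 mulr0 mul0r.
Qed.

End IdealGen.

(* Properness of the ideal is what makes the quotient below nontrivial, as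
   [algType] requires. *)
Record relator (k : fieldType) (F : algType k) := Relator {
  relator_val : F;
  relator_proper : 1 \notin ideal_gen relator_val
}.

Section Presented.
Context (k : fieldType) (F : algType k) (r : relator F).
Local Notation rel := (relator_val r).

Definition ideal_gen_zmod : zmodClosed F :=
  GRing.ZmodClosed.clone F (ideal_gen rel) _.

Definition presented : Type := Quotient.quot ideal_gen_zmod.

HB.instance Definition _ := GRing.Zmodule.on presented.
HB.instance Definition _ := EqQuotient.on presented.

Definition presented_pi (x : F) : presented :=
  \pi_(Quotient.quot ideal_gen_zmod) x.

Lemma presented_piP (x y : F) :
  presented_pi x = presented_pi y <-> x - y \in ideal_gen rel.
Proof.
have -> : (x - y \in ideal_gen rel) = (presented_pi x == presented_pi y).
  exact: (Quotient.idealrBE ideal_gen_zmod).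
by split=> [->|/eqP].
Qed.

Lemma presented_reprK : cancel (fun a : presented => repr a) presented_pi.
Proof. by move=> a; exact: reprK. Qed.

Lemma presented_piB : {morph presented_pi : x y / x - y}.
Proof. by move=> x y; rewrite /presented_pi raddfB. Qed.

Lemma presented_piD : {morph presented_pi : x y / x + y}.
Proof. by move=> x y; rewrite /presented_pi raddfD. Qed.

Definition presented_one : presented := presented_pi 1.
Definition presented_mul (a b : presented) : presented :=
  presented_pi (repr a * repr b).
Definition presented_scale (c : k) (a : presented) : presented :=
  presented_pi (c *: repr a).

Lemma repr_pi_ideal (x : F) : repr (presented_pi x) - x \in ideal_gen rel.
Proof. by apply/presented_piP; rewrite presented_reprK. Qed.

Lemma presented_pi_mul (x y : F) :
  presented_mul (presented_pi x) (presented_pi y) = presented_pi (x * y).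
Proof.
apply/presented_piP.
rewrite -[X in X - _](subrK (x * repr (presented_pi y))) -mulrBl -addrA -mulrBr.
by apply: rpredD; [apply: ideal_genMr|apply: ideal_genMl]; apply: repr_pi_ideal.
Qed.

Lemma presented_pi_scale (c : k) (x : F) :
  presented_scale c (presented_pi x) = presented_pi (c *: x).
Proof.
apply/presented_piP; rewrite -scalerBr -[X in _ *: X]mul1r scalerAl.
by apply: ideal_genMl; apply: repr_pi_ideal.
Qed.

Lemma presented_mulA : associative presented_mul.
Proof.
move=> a b c; rewrite -[a]presented_reprK -[b]presented_reprK.
by rewrite -[c]presented_reprK !presented_pi_mul mulrA.
Qed.

Lemma presented_mul1 : left_id presented_one presented_mul.
Proof. by move=> a; rewrite -[a]presented_reprK presented_pi_mul mul1r. Qed.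

Lemma presented_mulr1 : right_id presented_one presented_mul.
Proof. by move=> a; rewrite -[a]presented_reprK presented_pi_mul mulr1. Qed.

Lemma presented_mulDl : left_distributive presented_mul +%R.
Proof.
move=> a b c; rewrite -[a]presented_reprK -[b]presented_reprK.
rewrite -[c]presented_reprK -presented_piD !presented_pi_mul.
by rewrite mulrDl presented_piD.
Qed.

Lemma presented_mulDr : right_distributive presented_mul +%R.
Proof.
move=> a b c; rewrite -[a]presented_reprK -[b]presented_reprK.
rewrite -[c]presented_reprK -presented_piD !presented_pi_mul.
by rewrite mulrDr presented_piD.
Qed.

Lemma presented_one_neq0 : presented_one != 0.
Proof.
apply/eqP => one0; case/negP: (relator_proper r); rewrite -[1]subr0.
apply/presented_piP; rewrite [LHS]one0 -(subrr 1).
by rewrite presented_piB subrr.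
Qed.

HB.instance Definition _ := GRing.Zmodule_isNzRing.Build presented
  presented_mulA presented_mul1 presented_mulr1
  presented_mulDl presented_mulDr presented_one_neq0.

Lemma presented_scalerA (c d : k) (a : presented) :
  presented_scale c (presented_scale d a) = presented_scale (c * d) a.
Proof. by rewrite -[a]presented_reprK !presented_pi_scale scalerA. Qed.

Lemma presented_scale1r : left_id 1 presented_scale.
Proof. by move=> a; rewrite -[a]presented_reprK presented_pi_scale scale1r. Qed.

Lemma presented_scalerDr : right_distributive presented_scale +%R.
Proof.
move=> c a b; rewrite -[a]presented_reprK -[b]presented_reprK.
by rewrite -presented_piD !presented_pi_scale scalerDr presented_piD.
Qed.

Lemma presented_scalerDl (a : presented) :
  {morph presented_scale^~ a : c d / c + d}.
Proof.
move=> c d; rewrite -[a]presented_reprK.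
by rewrite !presented_pi_scale scalerDl presented_piD.
Qed.

HB.instance Definition _ := GRing.Zmodule_isLmodule.Build k presented
  presented_scalerA presented_scale1r presented_scalerDr presented_scalerDl.

Lemma presented_scalerAl (c : k) (a b : presented) :
  c *: (a * b) = (c *: a) * b.
Proof.
rewrite -[a]presented_reprK -[b]presented_reprK.
rewrite /GRing.mul /GRing.scale /=.
by rewrite !(presented_pi_mul, presented_pi_scale) scalerAl.
Qed.

HB.instance Definition _ :=
  GRing.Lmodule_isLalgebra.Build k presented presented_scalerAl.

Lemma presented_scalerAr (c : k) (a b : presented) :
  c *: (a * b) = a * (c *: b).
Proof.
rewrite -[a]presented_reprK -[b]presented_reprK.
rewrite /GRing.mul /GRing.scale /=.
by rewrite !(presented_pi_mul, presented_pi_scale) scalerAr.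
Qed.

HB.instance Definition _ :=
  GRing.Lalgebra_isAlgebra.Build k presented presented_scalerAr.

Lemma presented_pi_monoid_morphism : monoid_morphism presented_pi.
Proof. by split=> // x y; rewrite -presented_pi_mul. Qed.

Lemma presented_pi_scalable : scalable presented_pi.
Proof. by move=> c x; rewrite -presented_pi_scale. Qed.

HB.instance Definition _ :=
  GRing.isZmodMorphism.Build F presented presented_pi presented_piB.
HB.instance Definition _ :=
  GRing.isMonoidMorphism.Build F presented presented_pi
    presented_pi_monoid_morphism.
HB.instance Definition _ :=
  GRing.isScalable.Build k F presented *:%R presented_pi
    presented_pi_scalable.

Lemma presented_rel0 : presented_pi rel = 0.
Proof.
rewrite -(raddf0 presented_pi); apply/presented_piP/ideal_genP.
by exists [:: (1, 1)]; rewrite big_seq1 mul1r mulr1 subr0.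
Qed.

End Presented.

Section Relations.
Context (k : fieldType) (F : algType k) (u v : F).

Definition quantum_rel (q : k) : F := v * u - q *: (u * v).
Definition jordan_rel : F := v * u - u * v - u ^+ 2.

Lemma presented_quantumE (r : relator F) (q : k) :
  relator_val r = quantum_rel q ->
  presented_pi r v * presented_pi r u =
  q *: (presented_pi r u * presented_pi r v).
Proof.
move=> rE; have := presented_rel0 r; rewrite rE rmorphB /= linearZ /= !rmorphM.
by move/eqP; rewrite subr_eq0 => /eqP.
Qed.

Lemma presented_jordanE (r : relator F) :
  relator_val r = jordan_rel ->
  presented_pi r v * presented_pi r u =
  presented_pi r u * presented_pi r v + presented_pi r u ^+ 2.
Proof.
move=> rE; have := presented_rel0 r.
rewrite rE !rmorphB rmorphXn !rmorphM /= => /eqP.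
by rewrite -addrA -opprD subr_eq0 => /eqP.
Qed.

Context (eps : {rmorphism F -> k}) (eps_u : eps u = 0).

Lemma quantum_rel_proper (q : k) : 1 \notin ideal_gen (quantum_rel q).
Proof.
apply: (ideal_gen_const (eps := eps)).
by rewrite rmorphB -mulr_algl !rmorphM /= eps_u mul0r !mulr0 subr0.
Qed.

Lemma jordan_rel_proper : 1 \notin ideal_gen jordan_rel.
Proof.
apply: (ideal_gen_const (eps := eps)).
by rewrite !rmorphB rmorphXn !rmorphM eps_u expr0n /= mul0r mulr0 !subr0.
Qed.

End Relations.

Section Planes.
Context (k : fieldType).

Definition quantum_relator (q : k) : relator (free_alg k) :=
  Relator (quantum_rel_proper (free_v k) (free_const_u k) q).
Definition jordan_relator : relator (free_alg k) :=
  Relator (jordan_rel_proper (free_v k) (free_const_u k)).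

Definition quantum_plane (q : k) := presented (quantum_relator q).
Definition jordan_plane := presented jordan_relator.

Definition plane_u (r : relator (free_alg k)) : presented r :=
  presented_pi r (free_u k).
Definition plane_v (r : relator (free_alg k)) : presented r :=
  presented_pi r (free_v k).

Lemma quantum_planeE (q : k) :
  plane_v (quantum_relator q) * plane_u (quantum_relator q) =
  q *: (plane_u (quantum_relator q) * plane_v (quantum_relator q)).
Proof. exact: presented_quantumE. Qed.

Lemma jordan_planeE :
  plane_v jordan_relator * plane_u jordan_relator =
  plane_u jordan_relator * plane_v jordan_relator
  + plane_u jordan_relator ^+ 2.
Proof. exact: presented_jordanE. Qed.

End Planes.

(* [End_R(M)], acting on the left of [M]: the product is composition. *)
Section ModuleEndomorphisms.
Context (R : pzRingType) (M : lmodType R).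

Definition endo : Type := {linear M -> M}.

Definition endo_fun (f : endo) : M -> M := (f : {linear M -> M}).

Lemma endoP (f g : endo) : endo_fun f =1 endo_fun g -> f = g.
Proof.
case: f g => [f [[fD] [fZ]]] [g [[gD] [gZ]]] /funext fg.
rewrite /endo_fun /= in fg; subst g.
by rewrite (Prop_irrelevance fD gD) (Prop_irrelevance fZ gZ).
Qed.

HB.instance Definition _ := gen_eqMixin endo.
HB.instance Definition _ := gen_choiceMixin endo.

Definition endo_zero : endo := (\0 : M -> M).
Definition endo_opp (f : endo) : endo := \- endo_fun f.
Definition endo_add (f g : endo) : endo := endo_fun f \+ endo_fun g.
Definition endo_one : endo := (idfun : M -> M).
Definition endo_mul (f g : endo) : endo := endo_fun f \o endo_fun g.

End ModuleEndomorphisms.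
Section ModuleEndomorphismRing.
Context (R : pzRingType) (M : lmodType R).
Implicit Types f g h : endo M.

Lemma endo_addA : associative (@endo_add R M).
Proof. by move=> f g h; apply: endoP => x; exact: addrA. Qed.

Lemma endo_addC : commutative (@endo_add R M).
Proof. by move=> f g; apply: endoP => x; exact: addrC. Qed.

Lemma endo_add0 : left_id (endo_zero M) (@endo_add R M).
Proof. by move=> f; apply: endoP => x; exact: add0r. Qed.

Lemma endo_addN : left_inverse (endo_zero M) (@endo_opp R M) (@endo_add R M).
Proof. by move=> f; apply: endoP => x; exact: addNr. Qed.

HB.instance Definition _ := GRing.isZmodule.Build (endo M)
  endo_addA endo_addC endo_add0 endo_addN.

Lemma endo_mulA : associative (@endo_mul R M).
Proof. by move=> f g h; apply: endoP. Qed.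

Lemma endo_mul1 : left_id (endo_one M) (@endo_mul R M).
Proof. by move=> f; apply: endoP. Qed.

Lemma endo_mulr1 : right_id (endo_one M) (@endo_mul R M).
Proof. by move=> f; apply: endoP. Qed.

Lemma endo_mulDl : left_distributive (@endo_mul R M) +%R.
Proof. by move=> f g h; apply: endoP. Qed.

Lemma endo_mulDr : right_distributive (@endo_mul R M) +%R.
Proof. by move=> f g h; apply: endoP => x; exact: raddfD. Qed.

HB.instance Definition _ := GRing.Zmodule_isPzRing.Build (endo M)
  endo_mulA endo_mul1 endo_mulr1 endo_mulDl endo_mulDr.

End ModuleEndomorphismRing.

(* left actions by algebra automorphisms; invertibility follows from the two
   action axioms *)
Record alg_action (k : fieldType) (G : finGroupType) (A : algType k) :=
  AlgAction {
    act :> G -> {lrmorphism A -> A};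
    act1 : forall a, act 1%g a = a;
    actM : forall x y a, act (x * y)%g a = act x (act y a)
  }.

(* [A] as a right module over its ring of invariants, that is, as a left
   module over the converse ring *)
Definition over_invariants (k : fieldType) (G : finGroupType) (A : algType k)
  (to : alg_action G A) : Type := A.

Section Invariants.
Context (k : fieldType) (G : finGroupType) (A : algType k).
Context (to : alg_action G A).

Definition invariant : pred A := fun a => [forall x : G, to x a == a].

Lemma invariantP a : reflect (forall x : G, to x a = a) (a \in invariant).
Proof. by apply: (iffP forallP) => inva x; apply/eqP; apply: inva. Qed.

Lemma invariant_subring_closed : subring_closed invariant.
Proof.
split=> [|a b /invariantP ia /invariantP ib|a b /invariantP ia /invariantP ib];
  apply/invariantP => x.
- exact: rmorph1.
- by rewrite rmorphB /= ia ib.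
- by rewrite rmorphM /= ia ib.
Qed.

HB.instance Definition _ :=
  GRing.isSubringClosed.Build A invariant invariant_subring_closed.

Record invariant_ring : predArgType :=
  InvariantRing { inv_val : A; _ : inv_val \in invariant }.

HB.instance Definition _ := [isSub for inv_val].
HB.instance Definition _ := [Choice of invariant_ring by <:].
HB.instance Definition _ := [SubChoice_isSubNzRing of invariant_ring by <:].

Local Notation over_invariants := (over_invariants to).

HB.instance Definition _ := GRing.Zmodule.copy over_invariants A.

Definition inv_scale (b : invariant_ring^c) (a : over_invariants)
  : over_invariants := (a : A) * inv_val b.

Lemma inv_scalerA (b c : invariant_ring^c) (a : over_invariants) :
  inv_scale b (inv_scale c a) = inv_scale (b * c) a.
Proof. by rewrite /inv_scale -mulrA. Qed.

Lemma inv_scale1r : left_id 1 inv_scale.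
Proof. by move=> a; exact: mulr1. Qed.

Lemma inv_scalerDr : right_distributive inv_scale +%R.
Proof. by move=> b a a'; exact: mulrDl. Qed.

Lemma inv_scalerDl (a : over_invariants) :
  {morph inv_scale^~ a : b c / b + c}.
Proof. by move=> b c; exact: mulrDr. Qed.

HB.instance Definition _ :=
  GRing.Zmodule_isLmodule.Build invariant_ring^c over_invariants
    inv_scalerA inv_scale1r inv_scalerDr inv_scalerDl.

End Invariants.

(* [f] stands for the formal sum of the [f x] times [x] *)
Definition skew_group_ring (k : fieldType) (G : finGroupType) (A : algType k)
  (to : alg_action G A) : Type := {ffun G -> A}.

Section SkewGroupRing.
Context (k : fieldType) (G : finGroupType) (A : algType k).
Context (to : alg_action G A).

Local Notation skew_group_ring := (skew_group_ring to).

HB.instance Definition _ :=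
  GRing.Zmodule.copy skew_group_ring {ffun G -> A}.

Definition skew_coef (f : skew_group_ring) (x : G) : A :=
  (f : {ffun G -> A}) x.

Definition skew_single (a : A) (x : G) : skew_group_ring :=
  [ffun z => if z == x then a else 0].

Definition skew_mul (f g : skew_group_ring) : skew_group_ring :=
  [ffun z => \sum_(x : G) \sum_(y : G | (x * y)%g == z)
               skew_coef f x * to x (skew_coef g y)].

Definition skew_one : skew_group_ring := skew_single 1 1%g.

Lemma skew_coefP (f g : skew_group_ring) :
  skew_coef f =1 skew_coef g -> f = g.
Proof. by move=> fg; apply/ffunP. Qed.

Lemma skew_coefD (f g : skew_group_ring) x :
  skew_coef (f + g) x = skew_coef f x + skew_coef g x.
Proof. exact: ffunE. Qed.

Lemma skew_coef_single a x z :
  skew_coef (skew_single a x) z = if z == x then a else 0.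
Proof. exact: ffunE. Qed.

Lemma skew_mulE f g z :
  skew_coef (skew_mul f g) z =
  \sum_(x : G) skew_coef f x * to x (skew_coef g (x^-1 * z)%g).
Proof.
rewrite /skew_coef ffunE; apply: eq_bigr => x _.
rewrite (big_pred1 (x^-1 * z)%g) // => y.
by rewrite -(inj_eq (mulgI x^-1%g)) mulKg.
Qed.

Lemma skew_mulA : associative skew_mul.
Proof.
move=> f g h; apply: skew_coefP => z; rewrite !skew_mulE.
under eq_bigr => x _.
  rewrite skew_mulE rmorph_sum mulr_sumr.
  under eq_bigr => y _ do rewrite rmorphM /= mulrA -actM.
  over.
under [RHS]eq_bigr => x _ do rewrite skew_mulE mulr_suml.
rewrite [RHS]exchange_big /=; apply: eq_bigr => x _.
rewrite [RHS](reindex_inj (mulgI x)) /=; apply: eq_bigr => y _.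
by rewrite mulKg invMg mulgA.
Qed.

Lemma skew_mul1 : left_id skew_one skew_mul.
Proof.
move=> f; apply: skew_coefP => z; rewrite skew_mulE (bigD1 1%g) //=.
rewrite big1 ?addr0 => [|x /negPf x1].
  by rewrite skew_coef_single eqxx mul1r act1 invg1 mul1g.
by rewrite skew_coef_single x1 mul0r.
Qed.

Lemma skew_mulr1 : right_id skew_one skew_mul.
Proof.
move=> f; apply: skew_coefP => z; rewrite skew_mulE (bigD1 z) //=.
rewrite big1 ?addr0 => [|x /negPf xz].
  by rewrite skew_coef_single mulVg eqxx rmorph1 mulr1.
rewrite skew_coef_single -(inj_eq (mulgI x)) mulKVg mulg1 eq_sym xz.
by rewrite raddf0 mulr0.
Qed.

Lemma skew_mulDl : left_distributive skew_mul +%R.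
Proof.
move=> f g h; apply: skew_coefP => z; rewrite skew_coefD !skew_mulE -big_split.
by apply: eq_bigr => x _; rewrite skew_coefD mulrDl.
Qed.

Lemma skew_mulDr : right_distributive skew_mul +%R.
Proof.
move=> f g h; apply: skew_coefP => z; rewrite skew_coefD !skew_mulE -big_split.
by apply: eq_bigr => x _; rewrite skew_coefD raddfD mulrDr.
Qed.

Lemma skew_one_neq0 : skew_one != 0.
Proof.
apply/eqP => /(congr1 (fun f => skew_coef f 1%g)).
rewrite skew_coef_single eqxx /skew_coef ffunE => /eqP.
by rewrite oner_eq0.
Qed.

HB.instance Definition _ := GRing.Zmodule_isNzRing.Build skew_group_ring
  skew_mulA skew_mul1 skew_mulr1 skew_mulDl skew_mulDr skew_one_neq0.

Lemma skew_sum_single (f : skew_group_ring) :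
  f = \sum_(x : G) skew_single (skew_coef f x) x.
Proof.
apply/ffunP => z; rewrite sum_ffunE (bigD1 z) //= ffunE eqxx.
rewrite big1 ?addr0 // => x /negPf xz.
by rewrite ffunE eq_sym xz.
Qed.

Lemma skew_single_mul (a b : A) (x y : G) :
  skew_single a x * skew_single b y = skew_single (a * to x b) (x * y)%g.
Proof.
apply: skew_coefP => z; rewrite [LHS]skew_mulE (bigD1 x) //=.
rewrite big1 ?addr0 => [|w /negPf wx]; last first.
  by rewrite skew_coef_single wx mul0r.
rewrite !skew_coef_single eqxx -(inj_eq (mulgI x)) mulKVg.
by case: eqP => // _; rewrite raddf0 mulr0.
Qed.

End SkewGroupRing.

(* The pairs [(A, G)], with the action, for which [A^G] is a quantum Kleinian
   singularity.  [G] is any finite group with named generators; generators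
   satisfying the dihedral relations in a group of order [2n] give the
   presentation of [D_n], degenerate cases [n = 1, 2] included. *)
Inductive quantum_Kleinian (k : fieldType) :
    forall (A : algType k) (G : finGroupType), alg_action G A -> Prop :=
| QKcyclic (q : k) (n : nat) (w : k) (G : finGroupType) (g : G)
    (to : alg_action G (quantum_plane q)) of
    q != 0 & (0 < n)%N & n.+1.-primitive_root w
  & <[g]>%g = [set: G] & #[g]%g = n.+1%N
  & to g (plane_u _) = w *: plane_u _
  & to g (plane_v _) = w^-1 *: plane_v _
  : quantum_Kleinian to
| QKswap (G : finGroupType) (h : G)
    (to : alg_action G (quantum_plane (-1 : k))) of
    <[h]>%g = [set: G] & #[h]%g = 2%N
  & to h (plane_u _) = plane_v _
  & to h (plane_v _) = plane_u _
  : quantum_Kleinian to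
| QKdihedral (n : nat) (w : k) (G : finGroupType) (g h : G)
    (to : alg_action G (quantum_plane (-1 : k))) of
    (0 < n)%N & n.-primitive_root w
  & <<[set g; h]>>%g = [set: G] & #|G| = (2 * n)%N
  & (g ^+ n = 1)%g & (h ^+ 2 = 1)%g & ((h * g) ^+ 2 = 1)%g
  & to g (plane_u _) = w *: plane_u _
  & to g (plane_v _) = w^-1 *: plane_v _
  & to h (plane_u _) = plane_v _
  & to h (plane_v _) = plane_u _
  : quantum_Kleinian to
| QKjordan (G : finGroupType) (g : G)
    (to : alg_action G (jordan_plane k)) of
    <[g]>%g = [set: G] & #[g]%g = 2%N
  & to g (plane_u _) = - plane_u _
  & to g (plane_v _) = - plane_v _
  : quantum_Kleinian to.

(* Main.v *)
From HB Require Import structures.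
Require Import Defs.
From mathcomp Require Import all_boot all_order all_fingroup all_algebra.
From mathcomp Require Import cyclic generic_quotient boolp finmap monalg ring zify.
Set Implicit Arguments.
Unset Strict Implicit.
Unset Printing Implicit Defensive.
Import GRing.Theory.
Local Open Scope ring_scope.

(** Auslander's theorem for quantum Kleinian singularities.

    An element sum_x t_x x of the skew group ring acts on A by
    b |-> sum_x t_x x(b).  This is linear over the invariants and gives the
    ring morphism skew_endo, whose inverse is the isomorphism asked for.

    Let e be the sum of the elements of G.  If f in A lies in the two-sided
    ideal generated by e, say f = sum_i a_i e b_i, then f c is
    sum_i a_i tr(b_i c) with traces tr(b_i c) in the invariants, so that
    phi(f c) = sum_i phi(a_i) tr(b_i c) for every endomorphism phi: after left
    multiplication by f, phi comes from the skew group ring.  When this holds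
    for two coprime elements f1, f2, the presentations of phi f1 and phi f2
    agree on the common multiple f1 c1 = f2 c2; by coprimality the first one is
    divisible by f1, and the quotient presents phi.  This is
    auslander_criterion.  It applies to f1 = u^N and f2 = v^N, because u is a
    normal non-zero-divisor of the plane, modulo which v is regular.

    The properties of the planes follow from a normal form: every element is
    uniquely a sum of the p_i(v) u^i.  Both planes are instances of the
    relation vu = q uv + c u^2 with c (q - 1) = 0, and the normal form is
    obtained by letting the plane act from the right on k[Y][X], where u is
    the multiplication by X and v is an explicit operator (coordK).

    It remains to find powers of u and v in the ideal of e, that is, elements
    sum_i a_i (x) b_i for which sum_i a_i x(b_i) vanishes unless x = 1.  For a
    cyclic group sum_i u^(n-i) (x) u^i does it, since the powers of a nontrivial
    root of unity sum to 0.  For a dihedral group on the (-1)-plane, U = u^2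
    and V = v^2 are central, and a reflection fixes a line U = d V pointwise.
    An explicit element (klein_pairs) handles -1 together with the two
    reflections of one line; factors with central entries remove all other
    group elements, and summing over the lines leaves a power of u
    (dihedral_trace_u).  The swap action is the dihedral one with n = 1. *)

(** * The Auslander map and a criterion for its bijectivity *)

(** A sequence of pairs encodes an element of the tensor square of A; each f
    defines a contraction of it. *)
Definition twisted_sum (A : nzRingType) (s : seq (A * A)) (f : A -> A) : A :=
  \sum_(p <- s) p.1 * f p.2.

Section Auslander.
Context (k : fieldType) (G : finGroupType) (A : algType k).
Context (to : alg_action G A).
Local Notation Skew := (skew_group_ring to).
Local Notation M := (over_invariants to).

(** Intersection of A with the two-sided ideal of the skew group ring generated
    by the sum e of the group elements: the coefficient of x in sum_i a_i e b_i
    is sum_i a_i x(b_i). *)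
Definition trace_ideal (f : A) : Prop :=
  exists s, forall x : G, twisted_sum s (to x) = if x == 1%g then f else 0.

Definition skew_act (F : Skew) (b : M) : M :=
  \sum_x skew_coef F x * to x (b : A).

Lemma skew_act_linear F : linear (skew_act F).
Proof.
move=> c a b; have cinv := invariantP _ _ (valP (c : invariant_ring to)).
rewrite /skew_act /GRing.scale /= /inv_scale /=.
rewrite mulr_suml -big_split /=; apply: eq_bigr => x _.
by rewrite raddfD /= rmorphM /= (cinv x) mulrDr mulrA.
Qed.
HB.instance Definition _ F :=
  GRing.isLinear.Build _ M M _ (skew_act F) (skew_act_linear F).

(** The Auslander map. *)
Definition skew_endo (F : Skew) : endo M := (skew_act F : {linear M -> M}).

Lemma skew_endo_is_zmod_morphism : zmod_morphism skew_endo.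
Proof.
move=> E F; apply: endoP => b /=.
change (skew_act (E - F) b = skew_act E b - skew_act F b).
rewrite /skew_act -sumrB; apply: eq_bigr => x _.
by rewrite -mulrBl; congr (_ * _); rewrite /skew_coef !ffunE.
Qed.

Lemma skew_endo_is_monoid_morphism : monoid_morphism skew_endo.
Proof.
split=> [|E F]; apply: endoP => b /=.
  change (skew_act (skew_one to) b = b).
  rewrite /skew_act (bigD1 1%g) //= big1 => [|x /negPf x1].
    by rewrite skew_coef_single eqxx Defs.act1 mul1r addr0.
  by rewrite skew_coef_single x1 mul0r.
change (skew_act (skew_mul E F) b = skew_act E (skew_act F b)).
rewrite /skew_act; under eq_bigr => z _ do rewrite skew_mulE mulr_suml.
rewrite exchange_big; apply: eq_bigr => x _ /=.
rewrite rmorph_sum mulr_sumr (reindex_inj (mulgI x)) /=; apply: eq_bigr => y _.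
by rewrite mulKg rmorphM Defs.actM /= mulrA.
Qed.

HB.instance Definition _ :=
  GRing.isZmodMorphism.Build _ _ skew_endo skew_endo_is_zmod_morphism.
HB.instance Definition _ :=
  GRing.isMonoidMorphism.Build _ _ skew_endo skew_endo_is_monoid_morphism.

Lemma trace_invariant (b : A) : \sum_x to x b \in Defs.invariant to.
Proof.
apply/invariantP => y; rewrite rmorph_sum /= [RHS](reindex_inj (mulgI y)) /=.
by apply: eq_bigr => x _; rewrite Defs.actM.
Qed.

Lemma endo_invariantM (phi : endo M) (a b : A) :
  b \in Defs.invariant to -> endo_fun phi (a * b) = (endo_fun phi a : A) * b.
Proof.
move=> bI.
exact: (linearZ_LR (phi : {linear M -> M})
          (InvariantRing bI : (invariant_ring to)^c) a).
Qed.

Lemma actKV x a : to x (to x^-1%g a) = a.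
Proof. by rewrite -Defs.actM mulgV Defs.act1. Qed.
Lemma actVK x a : to x^-1%g (to x a) = a.
Proof. by rewrite -Defs.actM mulVg Defs.act1. Qed.

(** Let t be the difference of E and F.  As x a e = x(a) e in the skew group ring,
    t a e = t(a) e = 0 for all a in A; hence t f = 0 for f in the trace ideal.  The
    coefficient of h in t f is t_h h(f), so that t_h = 0. *)
Lemma skew_act_inj f (E F : Skew) :
    trace_ideal f -> (forall a, a * f = 0 -> a = 0) ->
    (forall b, skew_act E b = skew_act F b) -> E = F.
Proof.
move=> [s sE] freg EF; apply: skew_coefP => h.
apply/eqP; rewrite -subr_eq0; apply/eqP.
set t := fun x => skew_coef E x - skew_coef F x.
have t0 a : \sum_x t x * to x a = 0.
  under eq_bigr => x _ do rewrite mulrBl.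
  by rewrite sumrB; apply/eqP; rewrite subr_eq0; apply/eqP; exact: EF.
have : \sum_(p <- s) (\sum_x t x * to x p.1) * to h p.2 = 0.
  by apply: big1 => p _; rewrite t0 mul0r.
under eq_bigr => p _ do rewrite mulr_suml.
rewrite exchange_big /=.
have term x : \sum_(p <- s) t x * to x p.1 * to h p.2
    = if x == h then t h * to h f else 0.
  transitivity (t x * to x (twisted_sum s (to (x^-1 * h)%g))).
    rewrite /twisted_sum rmorph_sum mulr_sumr; apply: eq_bigr => p _ /=.
    by rewrite rmorphM /= -Defs.actM mulKVg mulrA.
  rewrite sE -(inj_eq (mulgI x)) mulKVg mulg1 eq_sym.
  by case: eqP => [->|_] //; rewrite raddf0 mulr0.
rewrite (eq_bigr _ (fun x _ => term x)) -big_mkcond big_pred1_eq => th.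
have := congr1 (to h^-1%g) th; rewrite rmorphM /= actVK raddf0.
by move=> /freg /(congr1 (to h)); rewrite actKV raddf0.
Qed.

(** Writing f = sum_i a_i e b_i gives f c = sum_i a_i tr(b_i c), and phi commutes
    with multiplication by the traces. *)
Lemma trace_ideal_endo f (phi : endo M) : trace_ideal f ->
  exists F : Skew, forall c, endo_fun phi (f * c : A) = skew_act F c.
Proof.
move=> [s sE].
exists ([ffun x => \sum_(p <- s) (endo_fun phi p.1 : A) * to x p.2] : {ffun G -> A}).
move=> c.
have -> : f * c = \sum_(p <- s) p.1 * \sum_x to x (p.2 * c).
  under eq_bigr => p _ do rewrite mulr_sumr.
  rewrite exchange_big (bigD1 1%g) //= [X in _ = _ + X]big1 => [|x x1].
    rewrite addr0; have := sE 1%g; rewrite eqxx => <-; rewrite mulr_suml.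
    by apply: eq_bigr => p _; rewrite rmorphM /= Defs.act1 Defs.act1 mulrA.
  have := sE x; rewrite (negPf x1) => E0.
  transitivity (twisted_sum s (to x) * to x c); last by rewrite E0 mul0r.
  rewrite mulr_suml.
  by apply: eq_bigr => p _; rewrite rmorphM /= mulrA.
rewrite /endo_fun raddf_sum /skew_act.
under [RHS]eq_bigr => x _ do rewrite /skew_coef ffunE mulr_suml.
rewrite exchange_big; apply: eq_bigr => p _ /=.
transitivity ((endo_fun phi p.1 : A) * \sum_x to x (p.2 * c)).
  by apply: endo_invariantM; exact: trace_invariant.
by rewrite mulr_sumr; apply: eq_bigr => x _; rewrite rmorphM mulrA.
Qed.

(** The hypothesis on s and t says that f1 c1 = f2 c2 is a least common left
    multiple of c1 and c2, so that a presentation of phi f1 can be divided by f1.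
    Two endomorphisms that agree on f1 A agree on A, because z is an invariant
    non-zero-divisor with A z contained in f1 A. *)
Lemma auslander_criterion (f1 f2 c1 c2 z : A) :
    trace_ideal f1 -> trace_ideal f2 ->
    f1 * c1 = f2 * c2 ->
    (forall s t, s * c1 = t * c2 -> exists r, s = r * f1) ->
    (forall a, a * f1 = 0 -> a = 0) ->
    z \in Defs.invariant to -> (forall a, a * z = 0 -> a = 0) ->
    (forall b, exists d, b * z = f1 * d) ->
  exists phi : {rmorphism endo M -> Skew}, bijective phi.
Proof.
move=> J1 J2 fc fdiv f1reg zI zreg znorm.
have inj : injective skew_endo.
  move=> E F EF; apply: (skew_act_inj J1 f1reg) => b.
  exact: (congr1 (fun h => endo_fun h b) EF).
have surj phi : exists F, skew_endo F = phi.
  have [S SE] := trace_ideal_endo phi J1; have [T TE] := trace_ideal_endo phi J2.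
  (* S and T present phi f1 and phi f2, which agree on f1 c1 = f2 c2. *)
  have coefE x : skew_coef S x * to x c1 = skew_coef T x * to x c2.
    pose S1 : Skew := ([ffun x => skew_coef S x * to x c1] : {ffun G -> A}).
    pose T1 : Skew := ([ffun x => skew_coef T x * to x c2] : {ffun G -> A}).
    suff /(congr1 (fun F => skew_coef F x)) : S1 = T1 by rewrite /skew_coef !ffunE.
    apply: (skew_act_inj J1 f1reg) => b.
    transitivity (skew_act S (c1 * b : A)).
      by apply: eq_bigr => y _; rewrite /skew_coef ffunE rmorphM mulrA.
    rewrite -SE mulrA fc -mulrA TE.
    by apply: eq_bigr => y _; rewrite /skew_coef ffunE rmorphM mulrA.
  have divE x : exists r, skew_coef S x = r * to x f1.
    have /fdiv[r rE] : to x^-1%g (skew_coef S x) * c1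
        = to x^-1%g (skew_coef T x) * c2.
      by have := congr1 (to x^-1%g) (coefE x); rewrite !rmorphM /= !actVK.
    by exists (to x r); rewrite -rmorphM -rE /= actKV.
  have [R RE] := boolp.choice divE.
  exists ([ffun x => R x] : {ffun G -> A}); apply: endoP => b.
  apply/eqP; rewrite -subr_eq0; apply/eqP; apply: zreg.
  rewrite mulrBl -!endo_invariantM //; apply/eqP; rewrite subr_eq0; apply/eqP.
  have [d ->] := znorm b; rewrite SE.
  by apply: eq_bigr => x _; rewrite /skew_coef ffunE rmorphM mulrA -RE.
have [g gE] := boolp.choice surj.
have can1 : cancel skew_endo g by move=> F; apply: inj; rewrite gE.
have can2 : cancel g skew_endo by [].
pose gR : {rmorphism endo M -> Skew} := HB.pack g
  (GRing.isZmodMorphism.Build _ _ g (can2_zmod_morphism can1 can2))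
  (GRing.isMonoidMorphism.Build _ _ g (can2_monoid_morphism can1 can2)).
by exists gR; exists skew_endo.
Qed.
End Auslander.

(** * Coordinates on the planes *)

Lemma free_alg_ind (k : fieldType) (P : free_alg k -> Prop) :
    P 1 -> (forall x y, P x -> P y -> P (x + y)) ->
    (forall c x, P x -> P (c *: x)) ->
    (forall x, P x -> P (x * free_u k)) ->
    (forall x, P x -> P (x * free_v k)) ->
  forall x, P x.
Proof.
move=> P1 PD PZ Pu Pv x.
have P0 : P 0 by rewrite -(scale0r 1); apply: PZ.
have Pm (s : seq 'I_2) : P << FMonom s >>.
  elim/last_ind: s => [|s i IHs]; first by rewrite -fmoneE.
  have -> : << FMonom (rcons s i) >> = (<< FMonom s >> : free_alg k) * << fmu i >>.
    rewrite [RHS]malgM_def fgmulUU mulr1; congr (mkmalgU _ _).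
    by apply/eqP; rewrite fmP fmM fmU cats1.
  case: (unliftP ord_max i) => [j ->|->]; last exact: Pv.
  by rewrite (ord1 j) (_ : lift _ _ = ord0); [exact: Pu|apply/val_inj].
rewrite [x]monalgE; apply: big_ind => // m _.
have -> : << x@_m *g m >> = x@_m *: (<< m >> : free_alg k).
  rewrite -mul_malgC malgM_def fgmulUU mulr1; congr (mkmalgU _ _).
  exact: (esym (fmmul1m m)).
by apply: PZ; rewrite -[m]fmK.
Qed.

(** The orbit map of 1 for the right action of the free algebra on S in which the
    two letters act by U and V.  The orbit map alone is enough to define
    coordinates, so the action need not become a ring morphism. *)
Lemma free_orbit (k : fieldType) (S : nzRingType) (f : {rmorphism k -> S})
    (U V : {additive S -> S}) :
    (forall c s, U (f c * s) = f c * U s) ->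
    (forall c s, V (f c * s) = f c * V s) ->
  exists T : {additive free_alg k -> S},
    [/\ T 1 = 1, forall c x, T (c *: x) = f c * T x,
        forall x, T (x * free_u k) = U (T x) &
        forall x, T (x * free_v k) = V (T x)].
Proof.
move=> Uf Vf; pose op (i : 'I_2) : {additive S -> S} := if i == ord0 then U else V.
pose word (m : {fmonom 'I_2}) : S := foldl (fun s i => op i s) 1 m.
pose T : {additive free_alg k -> S} := mmap f word.
have TU c m : T << c *g m >> = f c * word m by rewrite [LHS]mmapU.
have T_gen x i : T (x * << fmu i >>) = op i (T x).
  rewrite [x]monalgE mulr_suml 2!(raddf_sum T) (raddf_sum (op i)).
  apply: eq_bigr => m _; rewrite [X in T X]malgM_def fgmulUU mulr1 !TU.
  have -> : op i (f x@_m * word m) = f x@_m * op i (word m).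
    by rewrite /op; case: ifP.
  by rewrite /word [fmonom_val _]fmM fmU foldl_cat.
exists T; split=> [|c x|x|x].
- by rewrite TU rmorph1 mul1r /word [fmonom_val _]fm1.
- have cU d m : c *: << d *g m >> = << c * d *g m >> :> free_alg k.
    rewrite -mul_malgC malgM_def fgmulUU; congr (mkmalgU _ _); exact: (fmmul1m m).
  rewrite [x]monalgE scaler_sumr (raddf_sum T) [in RHS](raddf_sum T) mulr_sumr.
  by apply: eq_bigr => m _; rewrite cU !TU rmorphM mulrA.
- by rewrite T_gen.
- by rewrite T_gen.
Qed.

Lemma presented_skewE (k : fieldType) (F : algType k) (x y : F) (r : relator F)
    (q c : k) :
  relator_val r = y * x - q *: (x * y) - c *: (x * x) ->
  presented_pi r y * presented_pi r x =
  q *: (presented_pi r x * presented_pi r y)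
  + c *: (presented_pi r x * presented_pi r x).
Proof.
move=> rE; have := presented_rel0 r; rewrite rE.
rewrite !rmorphB /= !linearZ /= !rmorphM /= => /eqP.
by rewrite !scalerN -addrA -opprD subr_eq0 => /eqP.
Qed.

(** The presented algebra with relation vu = q uv + c u^2 is studied over an
    abstract algebra F with generators fu and fv, and T stands for the orbit
    map of free_orbit; the condition c q = c covers both the quantum plane
    (c = 0) and the Jordan plane (q = 1). *)
Section SkewPlane.
Context (k : fieldType) (q c : k).
Local Notation P := {poly {poly k}}.
Local Notation K a := ((a%:P)%:P : P).
(** Right multiplication by v in the basis v^j u^i, written Y^j X^i: from the
    relation, u^i v = q^-i v u^i - i c u^(i+1). *)
Definition right_v (p : P) : P :=
  'X%:P * (p \Po (K q^-1 * 'X)) - K c * ('X ^+ 2 * p^`()).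

Lemma right_v_is_zmod_morphism : zmod_morphism right_v.
Proof. by move=> x y; rewrite /right_v comp_polyB derivB; ring. Qed.
HB.instance Definition _ :=
  GRing.isZmodMorphism.Build P P right_v right_v_is_zmod_morphism.

Lemma right_vC (a : {poly k}) p : right_v (a%:P * p) = a%:P * right_v p.
Proof. by rewrite /right_v comp_polyM comp_polyC derivM derivC; ring. Qed.

Lemma right_v1 : right_v 1 = 'X%:P.
Proof. by rewrite /right_v comp_polyC derivC; ring. Qed.

Context (q0 : q != 0).
Context (cq : c * q = c).

(** The defining relation of the plane, for the operators of u and v. *)
Lemma right_vX p : right_v p * 'X = K q * right_v (p * 'X) + K c * (p * 'X * 'X).
Proof.
have qK : K q * K q^-1 = 1 by rewrite -!rmorphM /= mulfV.
have cqK : K c * K q = K c by rewrite -!rmorphM /= cq.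
rewrite /right_v comp_polyM comp_polyX derivM derivX.
set p1 := _ \Po _; set d := p^`().
transitivity ('X%:P * p1 * 'X * (K q * K q^-1)
  - (K c * K q) * ('X ^+ 2 * d * 'X + 'X ^+ 2 * p) + K c * (p * 'X * 'X)); last by ring.
rewrite qK cqK; ring.
Qed.

Context (F : algType k) (fu fv : F).
Context (Find : forall S : F -> Prop,
  S 1 -> (forall x y, S x -> S y -> S (x + y)) ->
  (forall c x, S x -> S (c *: x)) ->
  (forall x, S x -> S (x * fu)) -> (forall x, S x -> S (x * fv)) ->
  forall x, S x).
Context (T : {additive F -> P}).
Context (T1 : T 1 = 1) (TZ : forall d x, T (d *: x) = K d * T x)
  (Tu : forall x, T (x * fu) = T x * 'X) (Tv : forall x, T (x * fv) = right_v (T x)).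
Context (r : relator F).
Context (relE : relator_val r = fv * fu - q *: (fu * fv) - c *: (fu * fu)).
Local Notation A := (presented r).
Local Notation u := (presented_pi r fu).
Local Notation v := (presented_pi r fv).

Lemma plane_rel : v * u = q *: (u * v) + c *: (u * u).
Proof. exact: presented_skewE. Qed.

Lemma plane_rel' : u * v = q^-1 *: (v * u - c *: (u * u)).
Proof. by rewrite plane_rel addrK scalerA mulVf // scale1r. Qed.

Lemma plane_ind (S : A -> Prop) :
    S 1 -> (forall x y, S x -> S y -> S (x + y)) ->
    (forall d x, S x -> S (d *: x)) ->
    (forall x, S x -> S (x * u)) -> (forall x, S x -> S (x * v)) ->
  forall x, S x.
Proof.
move=> S1 SD SZ Su Sv a; rewrite -[a]presented_reprK.
elim/Find: (repr a) => [|x y|d x|x|x].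
- by rewrite rmorph1.
- by rewrite rmorphD; apply: SD.
- by rewrite linearZ; apply: SZ.
- by rewrite rmorphM; apply: Su.
- by rewrite rmorphM; apply: Sv.
Qed.

Lemma orbit_relator x y : T (x * relator_val r * y) = 0.
Proof.
elim/Find: y => [|y z|d y|y|y].
- rewrite mulr1 relE !mulrBr -!scalerAr !raddfB /= !TZ !mulrA.
  by rewrite !(Tu, Tv) right_vX; ring.
- by rewrite mulrDr raddfD /= => -> ->; rewrite addr0.
- by rewrite -scalerAr TZ => ->; rewrite mulr0.
- by rewrite mulrA Tu => ->; rewrite mul0r.
- by rewrite mulrA Tv => ->; rewrite raddf0.
Qed.

(** The orbit map vanishes on the ideal of the relation, so its value does not
    depend on the representative. *)
Definition coord (a : A) : P := T (repr a).
Lemma coord_pi x : coord (presented_pi r x) = T x.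
Proof.
apply/eqP; rewrite -subr_eq0 -raddfB /=.
have /ideal_genP[s ->] := repr_pi_ideal r x.
by rewrite raddf_sum big1 // => p _; rewrite /= orbit_relator.
Qed.

Lemma coord_is_zmod_morphism : zmod_morphism coord.
Proof.
move=> a b; rewrite -[a]presented_reprK -[b]presented_reprK -rmorphB.
by rewrite !coord_pi raddfB.
Qed.
HB.instance Definition _ :=
  GRing.isZmodMorphism.Build A P coord coord_is_zmod_morphism.

Lemma coordZ d a : coord (d *: a) = K d * coord a.
Proof. by rewrite -[a]presented_reprK -linearZ !coord_pi TZ. Qed.
Lemma coord1 : coord 1 = 1.
Proof. by rewrite -(rmorph1 (presented_pi r)) coord_pi T1. Qed.
Lemma coord_u a : coord (a * u) = coord a * 'X.
Proof. by rewrite -[a]presented_reprK -rmorphM !coord_pi Tu. Qed.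
Lemma coord_v a : coord (a * v) = right_v (coord a).
Proof. by rewrite -[a]presented_reprK -rmorphM !coord_pi Tv. Qed.

Definition eval_v (p : {poly k}) : A := horner_alg v p.
HB.instance Definition _ := GRing.RMorphism.copy eval_v (horner_alg v).
Definition of_coord (p : P) : A := \sum_(i < size p) eval_v p`_i * u ^+ i.

Lemma of_coordE n (p : P) : (size p <= n)%N ->
  of_coord p = \sum_(i < n) eval_v p`_i * u ^+ i.
Proof.
move=> le_n; rewrite /of_coord (big_ord_widen _ (fun i => eval_v p`_i * u ^+ i) le_n).
rewrite [RHS](bigID (fun i : 'I_n => (i < size p)%N)) /= [X in _ + X]big1 ?addr0 //.
by move=> i; rewrite -leqNgt => le_i; rewrite nth_default // rmorph0 mul0r.
Qed.
Lemma of_coord_is_zmod_morphism : zmod_morphism of_coord.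
Proof.
move=> x y; set n := maxn (size x) (size y).
rewrite (@of_coordE n (x - y)); last first.
  by rewrite (leq_trans (size_polyD _ _)) // size_polyN.
rewrite (@of_coordE n x) ?leq_maxl // (@of_coordE n y) ?leq_maxr // -sumrB.
by apply: eq_bigr => i _; rewrite coefB rmorphB mulrBl.
Qed.
HB.instance Definition _ :=
  GRing.isZmodMorphism.Build P A of_coord of_coord_is_zmod_morphism.

Lemma of_coordC a : of_coord a%:P = eval_v a.
Proof. by rewrite (@of_coordE 1) ?size_polyC_leq1 // big_ord1 coefC eqxx mulr1. Qed.
Lemma of_coord_u p : of_coord (p * 'X) = of_coord p * u.
Proof.
rewrite (@of_coordE (size p).+1) ?(leq_trans (size_polyMleq _ _)) ?size_polyX ?addn2 //.
rewrite big_ord_recl coefMX eqxx rmorph0 mul0r add0r mulr_suml.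
by apply: eq_bigr => i _; rewrite coefMX /= exprSr mulrA.
Qed.
Lemma of_coordZ d p : of_coord (K d * p) = d *: of_coord p.
Proof.
elim/poly_ind: p => [|p a IHp]; first by rewrite mulr0 raddf0 scaler0.
rewrite mulrDr mulrA 2!(raddfD of_coord) /= !of_coord_u IHp scalerDr scalerAl.
congr (_ + _).
rewrite -rmorphM /= !of_coordC rmorphM /= -mulr_algl; congr (_ * _).
exact: horner_algC.
Qed.

(** By induction on the degree in X; the step moves u past v with the relation
    solved for uv. *)
Lemma of_coord_v p : of_coord (right_v p) = of_coord p * v.
Proof.
elim/poly_ind: p => [|p a IHp]; first by rewrite !raddf0 mul0r.
have right_vD x y : right_v (x + y) = right_v x + right_v y by exact: raddfD.
have of_coordD x y : of_coord (x + y) = of_coord x + of_coord y by exact: raddfD.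
have of_coordB x y : of_coord (x - y) = of_coord x - of_coord y by exact: raddfB.
rewrite right_vD of_coordD [of_coord (_ * 'X + _)]of_coordD mulrDl of_coord_u.
congr (_ + _).
  have -> : right_v (p * 'X) = K q^-1 * (right_v p * 'X - K c * (p * 'X * 'X)).
    rewrite right_vX addrK mulrA -!rmorphM /= mulVf // !rmorph1 mul1r //.
  rewrite of_coordZ of_coordB of_coordZ !of_coord_u IHp -!mulrA.
  by rewrite plane_rel' -scalerAr mulrBr -scalerAr.
rewrite -[a%:P]mulr1 right_vC right_v1 mulr1 -rmorphM /= !of_coordC rmorphM /=.
by congr (_ * _); exact: horner_algX.
Qed.

(** The normal form: of_coord intertwines the operators of u and v with the
    right multiplications by u and v, so it carries the orbit of 1 in P back to
    the orbit of 1 in A. *)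
Lemma coordK : cancel coord of_coord.
Proof.
elim/plane_ind => [|x y Hx Hy|d x Hx|x Hx|x Hx].
- by rewrite coord1 of_coordC rmorph1.
- by rewrite !raddfD /= Hx Hy.
- by rewrite coordZ of_coordZ Hx.
- by rewrite coord_u of_coord_u Hx.
- by rewrite coord_v of_coord_v Hx.
Qed.

Lemma plane_u_rreg a : a * u = 0 -> a = 0.
Proof.
move=> au0; rewrite -[a]coordK; suff -> : coord a = 0 by rewrite raddf0.
have /eqP := congr1 coord au0; rewrite coord_u raddf0 mulf_eq0 polyX_eq0 orbF.
by move/eqP.
Qed.

Lemma coord0_div_u a : (coord a)`_0 = 0 -> exists b, a = b * u.
Proof.
move=> a0; exists (of_coord (\poly_(i < size (coord a)) (coord a)`_i.+1)).
rewrite -of_coord_u -[LHS]coordK; congr of_coord; apply/polyP => -[|i].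
  by rewrite a0 coefMX.
rewrite coefMX /= coef_poly; case: ltnP => // /leqW; exact: nth_default.
Qed.

(** The left ideal A u consists of the elements whose coordinate vanishes at
    X = 0, and there right multiplication by v is multiplication by Y. *)
Lemma plane_v_div a b : a * v = b * u -> exists d, a = d * u.
Proof.
move=> /(congr1 (fun x => (coord x).[0])); rewrite coord_v coord_u hornerMX mulr0.
rewrite /right_v hornerD hornerN !hornerM horner_comp !hornerM !hornerX !hornerC.
rewrite !mul0r !mulr0 subr0 => /eqP; rewrite mulf_eq0 polyX_eq0 /= => /eqP a0.
by apply: coord0_div_u; rewrite -horner_coef0.
Qed.

Lemma plane_u_normal a : exists b, a * u = u * b.
Proof.
elim/plane_ind: a => [|x y [x' Hx] [y' Hy]|d x [x' Hx]|x [x' Hx]|x [x' Hx]].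
- by exists 1; rewrite mul1r mulr1.
- by exists (x' + y'); rewrite mulrDl mulrDr Hx Hy.
- by exists (d *: x'); rewrite -scalerAl -scalerAr Hx.
- by exists (x' * u); rewrite Hx mulrA.
- exists (x' * (q *: v + c *: u)); rewrite -mulrA.
  have -> : v * u = u * (q *: v + c *: u) by rewrite plane_rel mulrDr -!scalerAr.
  by rewrite !mulrA Hx.
Qed.
End SkewPlane.

(** What the remaining proofs use of a plane: it is generated by u and v, u is a
    normal non-zero-divisor and v is regular modulo u.  Stating it for an abstract algebra keeps the
    quotient construction out of the computations. *)
Record plane_like (k : fieldType) (A : algType k) (u v : A) : Prop := PlaneLike {
  plane_like_ind : forall S : A -> Prop,
    S 1 -> (forall x y, S x -> S y -> S (x + y)) -> (forall d x, S x -> S (d *: x)) ->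
    (forall x, S x -> S (x * u)) -> (forall x, S x -> S (x * v)) -> forall x, S x;
  plane_like_reg : forall a, a * u = 0 -> a = 0;
  plane_like_div : forall a b, a * v = b * u -> exists d, a = d * u;
  plane_like_norm : forall a, exists b, a * u = u * b
}.

Lemma presented_plane_like (k : fieldType) (q c : k) (r : relator (free_alg k)) :
    q != 0 -> c * q = c ->
    relator_val r = free_v k * free_u k - q *: (free_u k * free_v k)
                    - c *: (free_u k * free_u k) ->
  plane_like (plane_u r) (plane_v r).
Proof.
move=> q0 cq rE.
pose U : {additive {poly {poly k}} -> {poly {poly k}}} := 'X \o* idfun.
pose V : {additive {poly {poly k}} -> {poly {poly k}}} := right_v q c.
pose f : {rmorphism k -> {poly {poly k}}} := polyC \o polyC.
have [||T [T1 TZ Tu Tv]] := @free_orbit k _ f U V.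
- by move=> d s; rewrite /U /= mulrA.
- by move=> d s; apply: right_vC.
split=> [S|a|a b|a].
- exact: (plane_ind (@free_alg_ind k)).
- exact: (plane_u_rreg q0 cq (@free_alg_ind k) T1 TZ Tu Tv rE).
- exact: (plane_v_div q0 cq (@free_alg_ind k) T1 TZ Tu Tv rE).
- exact: (plane_u_normal (@free_alg_ind k) rE).
Qed.

Lemma quantum_rel_skew (k : fieldType) (F : algType k) (x y : F) (q : k) :
  quantum_rel x y q = y * x - q *: (x * y) - 0 *: (x * x).
Proof. by rewrite scale0r subr0. Qed.

Lemma jordan_rel_skew (k : fieldType) (F : algType k) (x y : F) :
  jordan_rel x y = y * x - 1 *: (x * y) - 1 *: (x * x).
Proof. by rewrite !scale1r. Qed.

Lemma quantum_plane_like (k : fieldType) (q : k) : q != 0 ->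
  plane_like (plane_u (quantum_relator q)) (plane_v (quantum_relator q)).
Proof.
move=> q0; exact: (presented_plane_like (r := quantum_relator q) q0 (mul0r q)
  (quantum_rel_skew (free_u k) (free_v k) q)).
Qed.

Lemma jordan_plane_like (k : fieldType) :
  plane_like (plane_u (jordan_relator k)) (plane_v (jordan_relator k)).
Proof.
exact: (presented_plane_like (r := jordan_relator k) (oner_neq0 k) (mulr1 1)
  (jordan_rel_skew (free_u k) (free_v k))).
Qed.

Lemma expr_rreg (A : nzRingType) (x : A) n : (forall a, a * x = 0 -> a = 0) ->
  forall a, a * x ^+ n = 0 -> a = 0.
Proof.
move=> xreg; elim: n => [|n IHn] a; first by rewrite mulr1.
by rewrite exprSr mulrA => /xreg /IHn.
Qed.

Section PlaneLike.
Context (k : fieldType) (A : algType k) (u v : A).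
Context (uvA : plane_like u v).
Let ureg := plane_like_reg uvA.
Let vdiv := plane_like_div uvA.
Let unorm := plane_like_norm uvA.

Lemma central_of_generators (z : A) :
  z * u = u * z -> z * v = v * z -> forall a, z * a = a * z.
Proof.
move=> zu zv; elim/(plane_like_ind uvA) => [|x y Hx Hy|d x Hx|x Hx|x Hx].
- by rewrite mulr1 mul1r.
- by rewrite mulrDr mulrDl Hx Hy.
- by rewrite -scalerAr -scalerAl Hx.
- by rewrite mulrA Hx -!mulrA zu.
- by rewrite mulrA Hx -!mulrA zv.
Qed.

Lemma expr_unorm n a : exists b, a * u ^+ n = u ^+ n * b.
Proof.
elim: n => [|n [b IHn]]; first by exists a; rewrite mulr1 mul1r.
by have [d dE] := unorm b; exists d; rewrite exprSr mulrA IHn -mulrA dE mulrA.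
Qed.

Section Quantum.
Context (q : k) (q0 : q != 0) (vu : v * u = q *: (u * v)).

Lemma v_expru n : v * u ^+ n = q ^+ n *: (u ^+ n * v).
Proof.
elim: n => [|n IHn]; first by rewrite mulr1 mul1r scale1r.
rewrite [u ^+ n.+1]exprSr mulrA IHn -scalerAl -[_ * v * u]mulrA vu -scalerAr.
by rewrite scalerA !mulrA -!exprSr.
Qed.

Lemma exprv_expru m n : v ^+ m * u ^+ n = q ^+ (n * m) *: (u ^+ n * v ^+ m).
Proof.
elim: m => [|m IHm]; first by rewrite muln0 mulr1 mul1r scale1r.
rewrite mulnS [v ^+ m.+1]exprS -[LHS]mulrA IHm -scalerAr [v * (_ * _)]mulrA v_expru.
by rewrite -scalerAl scalerA -[_ * v * _]mulrA -exprD addnC.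
Qed.

Lemma exprv_div1 m a b : a * v ^+ m = b * u -> exists d, a = d * u.
Proof.
elim: m a b => [|m IHm] a b; first by rewrite mulr1 => ->; exists b.
by rewrite exprSr mulrA => /vdiv[d /IHm].
Qed.

(** The powers of u and v are coprime: one factor u is split off at a time, with
    the regularity of v modulo u, and is cancelled after moving it past v^m. *)
Lemma exprv_div m n a b : a * v ^+ m = b * u ^+ n -> exists d, a = d * u ^+ n.
Proof.
elim: n a b => [|n IHn] a b; first by exists a; rewrite mulr1.
rewrite exprSr mulrA => ab; have [d dE] := exprv_div1 ab.
move: ab; rewrite dE -[u in LHS]expr1 -mulrA.
have -> : u ^+ 1 * v ^+ m = q ^- m *: (v ^+ m * u).
  by rewrite -{2}[u]expr1 exprv_expru mul1n scalerA mulVf ?scale1r ?expf_neq0.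
rewrite -scalerAr mulrA scalerAl => /eqP; rewrite -subr_eq0 -mulrBl => /eqP/ureg/eqP.
rewrite subr_eq0 => /eqP/(congr1 ( *:%R (q ^+ m))).
rewrite scalerA divff ?expf_neq0 // scale1r scalerAl => /IHn[e ->].
by exists e; rewrite mulrA.
Qed.

Lemma quantum_auslander (G : finGroupType) (to : alg_action G A) (m n : nat) (z : A) :
    trace_ideal to (u ^+ n) -> trace_ideal to (v ^+ m) ->
    z \in Defs.invariant to -> (forall a, a * z = 0 -> a = 0) ->
    (exists y, z = u ^+ n * y) ->
  exists phi : {rmorphism endo (over_invariants to) -> skew_group_ring to},
    bijective phi.
Proof.
move=> Ju Jv zI zreg [y zE].
(* The scalar is the one that makes v^m c2 equal to u^n v^m. *)
apply: (@auslander_criterion _ _ _ to _ _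
  (v ^+ m) (q ^- (n * m) *: u ^+ n) z Ju Jv) => //.
- by rewrite -scalerAr exprv_expru scalerA mulVf ?scale1r ?expf_neq0.
- by move=> s t; rewrite -scalerAr scalerAl; apply: exprv_div.
- exact: expr_rreg.
- by move=> b; have [d dE] := expr_unorm n b; exists (d * y); rewrite zE !mulrA dE.
Qed.
End Quantum.
End PlaneLike.

(** * The trace ideal *)

Section TraceIdeal.
Context (k : fieldType) (G : finGroupType) (A : algType k) (to : alg_action G A).

Lemma trace_ideal0 : trace_ideal to 0.
Proof. by exists [::] => x; rewrite /twisted_sum big_nil; case: ifP. Qed.

Lemma trace_idealD f g : trace_ideal to f -> trace_ideal to g -> trace_ideal to (f + g).
Proof.
move=> [s sE] [t tE]; exists (s ++ t) => x.
rewrite /twisted_sum big_cat /= -!/(twisted_sum _ _) sE tE.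
by case: ifP; rewrite ?addr0.
Qed.

Lemma trace_idealZ c f : trace_ideal to f -> trace_ideal to (c *: f).
Proof.
move=> [s sE]; exists [seq (c *: p.1, p.2) | p <- s] => x.
rewrite /twisted_sum big_map /=; under eq_bigr => p _ do rewrite -scalerAl.
by rewrite -scaler_sumr -/(twisted_sum _ _) sE; case: ifP; rewrite ?scaler0.
Qed.

(** Transport of the presentation along y conjugates the group elements. *)
Lemma trace_ideal_act y f : trace_ideal to f -> trace_ideal to (to y f).
Proof.
move=> [s sE]; exists [seq (to y p.1, to y p.2) | p <- s] => x.
transitivity (to y (twisted_sum s (to (y^-1 * x * y)%g))).
  rewrite /twisted_sum big_map rmorph_sum /=; apply: eq_bigr => p _.
  by rewrite rmorphM /= -!Defs.actM !mulgA mulgV mul1g.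
by rewrite sE -mulgA -conjgE conjg_eq1; case: ifP => // _; rewrite raddf0.
Qed.

Lemma act_eigen g (a : A) c i : to g a = c *: a -> to (g ^+ i)%g a = c ^+ i *: a.
Proof.
move=> ga; elim: i => [|i IHi]; first by rewrite expg0 Defs.act1 scale1r.
by rewrite expgSr Defs.actM ga linearZ /= IHi scalerA exprS.
Qed.
End TraceIdeal.

Lemma root_of_unity_sum0 (k : fieldType) (n : nat) (c : k) :
  c ^+ n = 1 -> c != 1 -> \sum_(i < n) c ^+ i = 0.
Proof.
move=> cn c1; have /eqP := subrX1 c n.
by rewrite cn subrr eq_sym mulf_eq0 subr_eq0 (negPf c1) => /eqP.
Qed.

(** If f b = c a, the contraction by f is a geometric sum in c times a power of a.
    It vanishes when c is a nontrivial n-th root of unity, so these pairs separate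
    automorphisms by their eigenvalues. *)
Definition power_pairs (A : nzRingType) (a b : A) (n : nat) : seq (A * A) :=
  [seq (a ^+ (n.-1 - i), b ^+ i) | i : 'I_n <- enum 'I_n].

Lemma twisted_power_pairs (k : fieldType) (A : algType k) (f : {lrmorphism A -> A})
    (a b : A) (c : k) n :
  f b = c *: a ->
  twisted_sum (power_pairs a b n) f = (\sum_(i < n) c ^+ i) *: a ^+ n.-1.
Proof.
move=> fb; rewrite /twisted_sum big_map big_enum scaler_suml /=.
apply: eq_bigr => i _; rewrite rmorphXn /= fb exprZn -scalerAr -exprD.
by rewrite subnK // -ltnS prednK // (leq_ltn_trans _ (ltn_ord i)).
Qed.

(** * Cyclic groups *)

Section Cyclic.
Context (k : fieldType) (char0 : [pchar k] =i pred0).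
Context (G : finGroupType) (A : algType k) (to : alg_action G A) (g : G) (n : nat).
Context (gG : <[g]>%g = [set: G]) (og : #[g]%g = n.+1).

Lemma cyclic_elem (x : G) : exists2 i, (i < n.+1)%N & x = (g ^+ i)%g.
Proof.
have /cyclePmin[i] : x \in <[g]>%g by rewrite gG inE.
by rewrite og; exists i.
Qed.

Lemma cyclic_trace_ideal (w : k) (a : A) :
    (forall i, (w ^+ i == 1) = (n.+1 %| i)%N) -> to g a = w *: a ->
  trace_ideal to (a ^+ n).
Proof.
move=> wE ga.
have n0 : n.+1%:R != 0 :> k by rewrite (pcharf0P k).1.
suff J : trace_ideal to (n.+1%:R *: a ^+ n).
  by have := trace_idealZ n.+1%:R^-1 J; rewrite scalerA mulVf // scale1r.
exists (power_pairs a a n.+1) => x; have [i lt_i ->] := cyclic_elem x.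
rewrite (twisted_power_pairs _ (act_eigen i ga)) -order_dvdn og -wE /=.
case: eqP => [->|/eqP wi1].
  by under eq_bigr => j _ do rewrite expr1n; rewrite sumr_const card_ord.
rewrite root_of_unity_sum0 ?scale0r //.
by apply/eqP; rewrite -exprM wE dvdn_mull.
Qed.

Lemma cyclic_expr_invariant (w : k) (a : A) :
  w ^+ n.+1 = 1 -> to g a = w *: a -> a ^+ n.+1 \in Defs.invariant to.
Proof.
move=> w1 ga; apply/invariantP => x; have [i _ ->] := cyclic_elem x.
rewrite rmorphXn /= (act_eigen i ga) exprZn -exprM mulnC exprM w1 expr1n.
exact: scale1r.
Qed.
End Cyclic.

Section CyclicPlanes.
Context (k : fieldType) (char0 : [pchar k] =i pred0) (A : algType k) (u v : A).
Context (uvA : plane_like u v) (G : finGroupType) (to : alg_action G A).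
Local Notation auslander_iso :=
  (exists phi : {rmorphism endo (over_invariants to) -> skew_group_ring to},
    bijective phi).

Lemma auslander_cyclic (q w : k) (n : nat) (g : G) :
    q != 0 -> v * u = q *: (u * v) -> n.+1.-primitive_root w ->
    <[g]>%g = [set: G] -> #[g]%g = n.+1 ->
    to g u = w *: u -> to g v = w^-1 *: v ->
  auslander_iso.
Proof.
move=> q0 vu wn gG og gu gv.
have wE i : (w ^+ i == 1) = (n.+1 %| i)%N by rewrite -(prim_order_dvd wn).
have wVE i : (w^-1 ^+ i == 1) = (n.+1 %| i)%N by rewrite exprVn invr_eq1.
apply: (quantum_auslander uvA q0 vu (m := n) (n := n) (z := u ^+ n.+1)).
- exact: cyclic_trace_ideal wE gu.
- exact: cyclic_trace_ideal wVE gv.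
- exact: (cyclic_expr_invariant gG og (prim_expr_order wn) gu).
- exact: expr_rreg (plane_like_reg uvA).
- by exists u; rewrite exprSr.
Qed.

Lemma auslander_jordan (g : G) :
    v * u = u * v + u ^+ 2 -> <[g]>%g = [set: G] -> #[g]%g = 2%N ->
    to g u = - u -> to g v = - v ->
  auslander_iso.
Proof.
move=> vu gG og gu gv.
have sgE i : ((-1 : k) ^+ i == 1) = (2 %| i)%N.
  have two0 : 2%:R != 0 :> k by rewrite (pcharf0P k).1.
  rewrite -signr_odd dvdn2; case: (odd i); rewrite ?eqxx //= expr1.
  by rewrite eq_sym -subr_eq0 opprK; exact: (negPf two0).
rewrite -scaleN1r in gu; rewrite -scaleN1r in gv.
have Ju := cyclic_trace_ideal char0 gG og sgE gu.
have Jv := cyclic_trace_ideal char0 gG og sgE gv.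
(* Here f1 = u and f2 = v, with common multiple u (v + u) = v u. *)
apply: (@auslander_criterion _ _ _ to _ _ (v + u) u (u ^+ 2) Ju Jv) => //.
- by rewrite mulrDr vu.
- move=> s t; rewrite mulrDr expr1 => st.
  by apply: (plane_like_div uvA (b := t - s)); rewrite mulrBl -st addrK.
- exact: (plane_like_reg uvA).
- have N11 : (-1 : k) ^+ 2 = 1 by rewrite sqrrN expr1n.
  exact: (cyclic_expr_invariant gG og N11 gu).
- exact: expr_rreg (plane_like_reg uvA).
- by move=> b; have [d dE] := expr_unorm uvA 2 b; exists (u * d); rewrite dE mulrA.
Qed.
End CyclicPlanes.

(** * Dihedral groups *)

(** For anticommuting x and y, these pairs separate 1 from the other elements of
    the Klein group generated by -1 and the swap of x and y.  The first three
    pairs, with second entry of even degree, contract to 2 x^4 under 1 and to 0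
    under the swap, and so do the last four, where it is odd.  As -1 fixes the
    first part and changes the sign of the second, the sum has contraction 0
    under -1 and under its product with the swap. *)
Definition klein_pairs (A : nzRingType) (x y : A) : seq (A * A) :=
  [:: (x ^+ 2 *+ 2, x ^+ 2); (- (x ^+ 2 * y ^+ 2), 1); (y * x, x * y);
      (x, x ^+ 3); (- (x * y ^+ 2), x); (x ^+ 2 * x, x); (x ^+ 2 * y, y)].

Section KleinPairs.
Context (k : fieldType) (A : algType k) (x y : A) (f : {lrmorphism A -> A}).
Context (yx : y * x = - (x * y)).

Lemma yxA a : a * y * x = - (a * x * y).
Proof. by rewrite -!mulrA yx mulrN. Qed.

Let words := (@exprS A, @expr0 A, @mulr1 A, @mul1r A, rmorphM f, rmorph1 f).
Let nf := (@mulrNN A, @mulrN A, @mulNr A, @opprK A, yx, yxA).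

Lemma klein_pairs_id : f x = x -> f y = y ->
  twisted_sum (klein_pairs x y) f = x ^+ 4 *+ 4.
Proof.
move=> fx fy; rewrite /twisted_sum /klein_pairs !big_cons big_nil /= !words /= fx fy.
rewrite mulrnAl !mulrA !nf mulr2n.
set e := x * x * x * x; set d := x * x * y * y.
rewrite addr0 addKr [e + d]addrC addKr !mulrS mulr0n addr0.
by rewrite !addrA.
Qed.

Lemma klein_pairs_opp : f x = - x -> f y = - y ->
  twisted_sum (klein_pairs x y) f = 0.
Proof.
move=> fx fy; rewrite /twisted_sum /klein_pairs !big_cons big_nil /= !words /= fx fy.
rewrite mulrnAl !mulrA !nf mulr2n.
set e := x * x * x * x; set d := x * x * y * y.
by rewrite addr0 addKr [- e - d]addrC addNKr -opprD subrr.
Qed.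

Lemma klein_pairs_swap : f x = y -> f y = x ->
  twisted_sum (klein_pairs x y) f = 0.
Proof.
move=> fx fy; rewrite /twisted_sum /klein_pairs !big_cons big_nil /= !words /= fx fy.
rewrite mulrnAl !mulrA !nf mulr2n.
set e := x * x * x * x; set d := x * x * y * y.
by rewrite addr0 subrr addr0 subrr addr0 -opprD subrr.
Qed.

Lemma klein_pairs_swap_opp : f x = - y -> f y = - x ->
  twisted_sum (klein_pairs x y) f = 0.
Proof.
move=> fx fy; rewrite /twisted_sum /klein_pairs !big_cons big_nil /= !words /= fx fy.
rewrite mulrnAl !mulrA !nf mulr2n.
set e := x * x * x * x; set d := x * x * y * y.
by rewrite addr0 addNr addr0 addNr addr0 -opprD subrr.
Qed.
End KleinPairs.

Definition pairs_mul (A : nzRingType) (s t : seq (A * A)) : seq (A * A) :=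
  [seq (p.1 * r.1, p.2 * r.2) | p <- s, r <- t].

(** Contraction is multiplicative when the left entries of the second factor are
    central, so each factor can take care of its own group elements. *)
Lemma twisted_sum_mul (A : nzRingType) (s t : seq (A * A)) (f : {rmorphism A -> A}) :
    (forall p a, p \in t -> p.1 * a = a * p.1) ->
  twisted_sum (pairs_mul s t) f = twisted_sum s f * twisted_sum t f.
Proof.
move=> tC; rewrite /twisted_sum big_allpairs_dep mulr_suml; apply: eq_bigr => p _.
rewrite mulr_sumr; apply: eq_big_seq => r rt /=.
by rewrite rmorphM -!mulrA; congr (_ * _); rewrite !mulrA tC.
Qed.

Lemma power_pairs_central (A : nzRingType) (a b : A) n :
    (forall c, a * c = c * a) ->
  forall p c, p \in power_pairs a b n -> p.1 * c = c * p.1.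
Proof.
move=> aC p c /mapP[i _ ->] /=; apply: commr_sym; apply: commrX; exact: esym (aC c).
Qed.

(** The hypothesis elts describes the dihedral action through eigenvalues: a
    nontrivial element is a rotation u |-> c u, v |-> c^-1 v or a reflection
    u |-> c v, v |-> c^-1 u, for an (n+1)-st root of unity c. *)
Section Dihedral.
Context (k : closedFieldType) (char0 : [pchar k] =i pred0).
Context (A : algType k) (u v : A).
Context (vu : v * u = - (u * v)).
Context (UC : forall a, u ^+ 2 * a = a * u ^+ 2).
Context (VC : forall a, v ^+ 2 * a = a * v ^+ 2).
Context (G : finGroupType) (to : alg_action G A) (n : nat) (w : k).
Context (wn : n.+1.-primitive_root w).
Context (elts : forall x : G, x != 1%g -> exists2 c, c ^+ n.+1 = 1 &
  [/\ c != 1, to x u = c *: u & to x v = c^-1 *: v] \/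
  (to x u = c *: v /\ to x v = c^-1 *: u)).

Lemma unity_root_neq0 (c : k) : c ^+ n.+1 = 1 -> c != 0.
Proof.
by move=> cn; apply: contra_eq_neq cn => ->; rewrite expr0n eq_sym oner_eq0.
Qed.

(** The three factors remove, in this order: -1 and the reflections with c^2 = d,
    for which u and b v are swapped up to sign; the rotations with c^2 != 1,
    which multiply u^2 by c^2; the reflections with c^2 != d, which send u^2 to
    c^2 / d times d v^2. *)
Lemma dihedral_trace_line (d b : k) : d ^+ n.+1 = 1 -> b ^+ 2 = d ->
  trace_ideal to (u ^+ 4 *+ 4 * (n.+1%:R *: (u ^+ 2) ^+ n) *
    \sum_(i < n.+1) (d *: v ^+ 2) ^+ (n - i) * (u ^+ 2) ^+ i).
Proof.
move=> dn bd; set y := b *: v.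
have yu : y * u = - (u * y) by rewrite -scalerAl vu -scalerAr scalerN.
have dVC a : d *: v ^+ 2 * a = a * (d *: v ^+ 2) by rewrite -scalerAl VC scalerAr.
exists (pairs_mul (pairs_mul (klein_pairs u y) (power_pairs (u ^+ 2) (u ^+ 2) n.+1))
                  (power_pairs (d *: v ^+ 2) (u ^+ 2) n.+1)) => x.
rewrite !twisted_sum_mul; [|exact: power_pairs_central..].
case: eqP => [->|/eqP /elts[c cn]].
  rewrite klein_pairs_id ?Defs.act1 //; congr (_ * _ * _).
    rewrite (@twisted_power_pairs _ _ _ _ _ 1) ?scale1r ?Defs.act1 //.
    by under eq_bigr => i _ do rewrite expr1n; rewrite sumr_const card_ord.
  rewrite /twisted_sum big_map big_enum; apply: eq_bigr => i _ /=.
  by rewrite Defs.act1.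
have c2n : (c ^+ 2) ^+ n.+1 = 1 by rewrite -exprM mulnC exprM cn expr1n.
have c0 := unity_root_neq0 cn.
case=> [[c1 xu xv]|[xu xv]].
  have [c21|c21] := eqVneq (c ^+ 2) 1; last first.
    rewrite [X in _ * X * _](@twisted_power_pairs _ _ _ _ _ (c ^+ 2)).
      by rewrite root_of_unity_sum0 // scale0r mulr0 mul0r.
    by rewrite rmorphXn /= xu exprZn.
  have cN1 : c = -1 by move/eqP: c21; rewrite sqrf_eq1 (negPf c1) => /eqP.
  rewrite cN1 in xu xv.
  rewrite klein_pairs_opp ?mul0r //= ?xu ?scaleN1r // /y linearZ /= xv.
  by rewrite invrN invr1 scaleN1r scalerN.
have [dc|dc] := eqVneq d (c ^+ 2); last first.
  rewrite [X in _ * X](@twisted_power_pairs _ _ _ _ _ (c ^+ 2 / d)).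
    rewrite root_of_unity_sum0 ?scale0r ?mulr0 //.
      by rewrite expr_div_n c2n dn divr1.
    by apply: contra_neq dc => /divr1_eq.
  rewrite rmorphXn /= xu exprZn scalerA divfK //.
  exact: unity_root_neq0.
have /eqP := bd; rewrite dc eqf_sqr => /orP[] /eqP bc.
  rewrite klein_pairs_swap ?mul0r //= /y ?linearZ /= bc //.
  by rewrite xv scalerA divff // scale1r.
rewrite klein_pairs_swap_opp ?mul0r //; first by rewrite /y bc scaleNr opprK.
by rewrite /y bc linearZ /= xv scalerA mulNr divff // scaleN1r.
Qed.

(** Summing the elements of dihedral_trace_line over all (n+1)-st roots of unity
    d kills the terms with a positive power of v^2 and leaves a power of u. *)
Lemma dihedral_trace_u : trace_ideal to (u ^+ (4 + 2 * n + 2 * n)).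
Proof.
have sqrtk (d : k) : exists b, b ^+ 2 = d.
  have [//|b] := @solve_monicpoly k 2 (fun i => if i == 0%N then d else 0).
  by rewrite big_ord_recl big_ord1 /= mulr1 mul0r addr0; exists b.
set F := fun d : k => \sum_(i < n.+1) (d *: v ^+ 2) ^+ (n - i) * (u ^+ 2) ^+ i.
set H := u ^+ 4 *+ 4 * (n.+1%:R *: (u ^+ 2) ^+ n).
have J : trace_ideal to (\sum_(l < n.+1) H * F (w ^+ l)).
  apply: big_ind => [||l _]; [exact: trace_ideal0|exact: trace_idealD|].
  have [b bE] := sqrtk (w ^+ l); apply: dihedral_trace_line bE.
  by rewrite -exprM mulnC exprM (prim_expr_order wn) expr1n.
have sumF : \sum_(l < n.+1) F (w ^+ l) = n.+1%:R *: (u ^+ 2) ^+ n.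
  rewrite exchange_big big_ord_recr /= big1 ?add0r => [|i _].
    under eq_bigr => l _ do rewrite subnn expr0 mul1r.
    by rewrite sumr_const card_ord scaler_nat.
  rewrite -mulr_suml; under eq_bigr => l _ do rewrite exprZn -exprM mulnC exprM.
  rewrite -scaler_suml root_of_unity_sum0 ?scale0r ?mul0r //.
    by rewrite -exprM mulnC exprM (prim_expr_order wn) expr1n.
  by rewrite -(prim_order_dvd wn) gtnNdvd ?subn_gt0 // ltnS leq_subr.
have n0 : n.+1%:R != 0 :> k by rewrite (pcharf0P k).1.
have four0 : 4%:R != 0 :> k by rewrite (pcharf0P k).1.
have := trace_idealZ (4%:R * n.+1%:R * n.+1%:R)^-1 J; rewrite -mulr_sumr sumF /H.
rewrite -scaler_nat -!scalerAl -!scalerAr !scalerA -!exprM -!scalerAl scalerA.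
rewrite -!exprD.
by rewrite -!mulrA mulVf ?scale1r ?mulf_neq0.
Qed.
End Dihedral.

Lemma dihedral_elem (G : finGroupType) (g h : G) (n : nat) :
    (0 < n)%N -> <<[set g; h]>>%g = [set: G] ->
    (g ^+ n = 1)%g -> (h ^+ 2 = 1)%g -> ((h * g) ^+ 2 = 1)%g ->
  forall x, exists2 i, (i < n)%N & x = (g ^+ i)%g \/ x = (g ^+ i * h)%g.
Proof.
move=> n0 gen gn h2 hg2 x.
have ghg : (g ^ h = g^-1)%g.
  have hV : (h^-1 = h)%g by apply/eqP; rewrite eq_invg_mul -expg2 h2.
  by apply: (mulIg g); rewrite mulVg conjgE hV -hg2 expg2 !mulgA.
have hN : h \in 'N(<[g]>)%g by rewrite inE -cycleJ ghg cycleV.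
have : x \in (<[g]> * <[h]>)%g.
  by rewrite -norm_joinEr ?cycle_subG // joing_idl joing_idr /joing gen inE.
case/mulsgP => y z /cycleP[i ->] /cycleP[j ->] ->.
exists (i %% n)%N; first by rewrite ltn_mod.
rewrite (expg_mod _ gn) -(expg_mod j h2) modn2.
by case: (odd j); [right; rewrite expg1|left; rewrite mulg1].
Qed.

(** The automorphism h carries the results for u over to v: the membership of
    v^N in the trace ideal and the regularity of v. *)
Lemma auslander_dihedral (k : closedFieldType) (char0 : [pchar k] =i pred0)
    (A : algType k) (u v : A) (uvA : plane_like u v)
    (G : finGroupType) (to : alg_action G A) (w : k) (n : nat) (g h : G) :
    v * u = - (u * v) -> n.+1.-primitive_root w ->
    (forall x : G, exists2 i, (i < n.+1)%N & x = (g ^+ i)%g \/ x = (g ^+ i * h)%g) ->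
    to g u = w *: u -> to g v = w^-1 *: v -> to h u = v -> to h v = u ->
  exists phi : {rmorphism endo (over_invariants to) -> skew_group_ring to},
    bijective phi.
Proof.
move=> vu wn elts gu gv hu hv.
have UC a : u ^+ 2 * a = a * u ^+ 2.
  apply: (central_of_generators uvA); first by rewrite -exprSr -exprS.
  by rewrite expr2 mulrA vu mulNr -!mulrA vu mulrN opprK.
have VC a : v ^+ 2 * a = a * v ^+ 2.
  apply: (central_of_generators uvA); last by rewrite -exprSr -exprS.
  by rewrite expr2 -mulrA vu mulrN mulrA vu mulNr opprK -mulrA.
have wi1 i : (w ^+ i) ^+ n.+1 = 1.
  by rewrite -exprM mulnC exprM (prim_expr_order wn) expr1n.
have giu i : to (g ^+ i)%g u = w ^+ i *: u by apply: act_eigen.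
have giv i : to (g ^+ i)%g v = w ^- i *: v by rewrite -exprVn; apply: act_eigen.
have xuv x : exists2 c, c ^+ n.+1 = 1 &
    [/\ x != 1%g -> c != 1, to x u = c *: u & to x v = c^-1 *: v] \/
    (to x u = c *: v /\ to x v = c^-1 *: u).
  have [i lt_i [] ->] := elts x.
    exists (w ^+ i) => //; left; split=> //; apply: contra_neq => /eqP wi.
    rewrite -(prim_order_dvd wn) in wi; have [->//|i0] := posnP i.
    by rewrite gtnNdvd in wi.
  exists (w ^- i); first by rewrite exprVn wi1 invr1.
  by right; rewrite !Defs.actM hu hv giu giv invrK.
have Ju : trace_ideal to (u ^+ (4 + 2 * n + 2 * n)).
  apply: (dihedral_trace_u char0 vu UC VC wn) => x x1.
  by have [c cn [[/(_ x1)]|]] := xuv x; exists c => //; [left|right].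
have Jv : trace_ideal to (v ^+ (4 + 2 * n + 2 * n)).
  by have := trace_ideal_act h Ju; rewrite rmorphXn /= hu.
set N := (4 + 2 * n + 2 * n)%N in Ju Jv.
have NE : N = (n.+1 * 4)%N by rewrite /N; lia.
have N2 : N = (2 * n.+1.*2)%N by rewrite /N -muln2; lia.
have scaleN (c : k) (a : A) : c ^+ n.+1 = 1 -> (c *: a) ^+ N = a ^+ N.
  by move=> cn; rewrite exprZn NE exprM cn expr1n scale1r.
have uvC : v ^+ N * u ^+ N = u ^+ N * v ^+ N.
  by rewrite N2 !exprM; apply: commrX; apply: commr_sym; apply: commrX; exact: UC.
have vreg a : a * v = 0 -> a = 0.
  move=> av; rewrite -[a](actVK to h); have := congr1 (to h) av.
  rewrite rmorphM raddf0 /= hv => /(plane_like_reg uvA) ->; exact: raddf0.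
have q0 : -1 != 0 :> k by rewrite oppr_eq0 oner_neq0.
have vu' : v * u = -1 *: (u * v) by rewrite scaleN1r.
apply: (quantum_auslander uvA q0 vu' (m := N) (n := N) (z := u ^+ N * v ^+ N)) => //.
- apply/invariantP => x; have [c cn xE] := xuv x.
  have c'n : c^-1 ^+ n.+1 = 1 by rewrite exprVn cn invr1.
  rewrite rmorphM !rmorphXn /=; case: xE => [[_ -> ->]|[-> ->]].
    by rewrite !scaleN.
  by rewrite !scaleN.
- move=> a; rewrite mulrA => /(expr_rreg vreg).
  exact: expr_rreg (plane_like_reg uvA) _.
- by exists (v ^+ N).
Qed.

(** * The theorem *)

Theorem theorem1p5 (k : closedFieldType) (char0 : [pchar k] =i pred0)
    (A : algType k) (G : finGroupType) (to : alg_action G A)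
    (qK : quantum_Kleinian to) :
  exists phi : {rmorphism endo (over_invariants to) -> skew_group_ring to},
    bijective phi.
Proof.
have N1 : -1 != 0 :> k by rewrite oppr_eq0 oner_neq0.
case: A G to / qK.
- move=> q n w G g to q0 _ wn gG og gu gv.
  exact: (auslander_cyclic char0 (quantum_plane_like q0) q0 (quantum_planeE q)
    wn gG og gu gv).
- move=> G h to hG oh hu hv; have vu := quantum_planeE (-1 : k).
  rewrite scaleN1r in vu.
  have prim1 : 1.-primitive_root (1 : k).
    apply/andP; split=> //; apply/forallP => i.
    by rewrite ord1 unity_rootE expr1 !eqxx.
  (* The swap is the dihedral action with n = 1 and trivial rotation. *)
  apply: (auslander_dihedral (g := 1%g) (h := h) char0
    (quantum_plane_like N1) vu prim1) => //.
  + move=> x; have /cyclePmin[i] : x \in <[h]>%g by rewrite hG inE.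
    rewrite oh => lt_i ->; exists 0%N => //; rewrite expg0 mul1g.
    by case: i lt_i => [|[|]] // _; [left; rewrite expg0|right; rewrite expg1].
  + by rewrite Defs.act1 scale1r.
  + by rewrite Defs.act1 invr1 scale1r.
- move=> [//|n] w G g h to _ wn gen _ gn h2 hg2 gu gv hu hv.
  have vu := quantum_planeE (-1 : k); rewrite scaleN1r in vu.
  have elts := dihedral_elem (ltn0Sn n) gen gn h2 hg2.
  exact: (auslander_dihedral char0 (quantum_plane_like N1) vu wn elts
    gu gv hu hv).
- move=> G g to gG og gu gv.
  exact: (auslander_jordan char0 (jordan_plane_like k) (jordan_planeE k)
    gG og gu gv).
Qed.
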